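(* Assume the linear program $\min_{x\ge 0} c^\top x$ s.t. $Ax=b$ is feasible and bounded, and let $\mathcal Z^*$ be its set of primal-dual optimal solutions. Let $\{z^{n,k}\}$ be the iterates of reflected restarted Halpern PDHG with the fixed frequency restart scheme, i.e. each inner loop is terminated at $k=k^*:=\left\lceil\frac{e}{\alpha_\eta}\right\rceil$. Then for every $n\ge 0$, $$\mathrm{dist}(z^{n+1,0},\mathcal Z^* )\le \left(\frac1e\right)^{n+1}\mathrm{dist}(z^{0,0},\mathcal Z^* ).$$
   Context: Let $A\in\mathbb R^{m\times d}$ be nonzero, $b\in\mathbb R^m$, $c\in\mathbb R^d$. The LP has primal-dual form $\min_{x\ge 0}\max_{y} c^\top x+y^\top Ax-b^\top y$; write $z=(x,y)\in\mathbb R^{d+m}$. $\mathcal Z^*$ is the set of saddle points (primal-dual optimal solutions). $\|\cdot\|_2$ is the Euclidean norm for vectors and the spectral norm for matrices. Fix a step-size $0<\eta\le\frac{1}{2\|A\|_2}$. The PDHG operator $T(x,y)=(x^+,y^+)$ is $$x^+=\mathrm{proj}_{\mathbb R^d_+}(x-\eta A^\top y-\eta c),\qquad y^+=y+\eta A(2x^+-x)-\eta b.$$ Then $\mathcal Z^*=\{z: T(z)=z\}$. Let $P_\eta=\begin{pmatrix}\frac1\eta I&-A^\top\\-A&\frac1\eta I\end{pmatrix}$ and $\|z\|=\sqrt{\langle z,P_\eta z\rangle}$; $\mathrm{dist}(z,\mathcal U)=\inf_{u\in\mathcal U}\|z-u\|$. Reflected restarted Halpern PDHG: start from $z^{0,0}$.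 In outer loop $n=0,1,2,\dots$, for inner counter $k=0,1,\dots$ set $$z^{n,k+1}=\frac{k+1}{k+2}\big(2T(z^{n,k})-z^{n,k}\big)+\frac1{k+2}z^{n,0}$$ until the restart condition holds at the current $k$; then set $z^{n+1,0}=T(z^{n,k})$ with this $k$ and start outer loop $n+1$. Sharpness constant: fix $\tilde z^*\in\mathcal Z^*$ and let $R=2(\|z^{0,0}-\tilde z^*\|_2+\|\tilde z^*\|_2)$. $\alpha_\eta>0$ is a constant such that $\alpha_\eta\,\mathrm{dist}(z,\mathcal Z^* )\le\|z-T(z)\|$ for every $z$ with $\|T(z)\|_2\le R$ (such a constant exists). *)

(* Defs.v *)
From HB Require Import structures.
From mathcomp Require Import all_boot all_order all_algebra.
From mathcomp Require Import all_classical all_reals.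
From mathcomp Require Import sequences exp.

Set Implicit Arguments.
Unset Strict Implicit.
Unset Printing Implicit Defensive.

Import Order.TTheory GRing.Theory Num.Theory.
Local Open Scope classical_set_scope.
Local Open Scope ring_scope.

Section Euclidean.
Context {R : realType}.

Definition dotv n (u v : 'cV[R]_n) : R := (u^T *m v) 0 0.

(* Euclidean norm; the norm `|v| that the library puts on matrices is the
   max norm. *)
Definition norm2 n (v : 'cV[R]_n) : R := Num.sqrt (dotv v v).

(* Spectral norm, i.e. the operator norm induced by [norm2]. *)
Definition spectral_norm m n (A : 'M[R]_(m, n)) : R :=
  sup [set norm2 (A *m x) | x in [set x : 'cV[R]_n | norm2 x <= 1]].

Definition nonneg n : set 'cV[R]_n := [set x | forall i, 0 <= x i 0].

(* Euclidean projection of v onto C.  For closed convex nonempty C, such as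
   [nonneg n], the nearest point exists and is unique, so the default value v
   of [xget] is not used. *)
Definition proj n (C : set 'cV[R]_n) (v : 'cV[R]_n) : 'cV[R]_n :=
  xget v [set p | C p /\ forall q, C q -> norm2 (v - p) <= norm2 (v - q)].

End Euclidean.

(* A primal-dual vector z = (x, y) is [col_mx x y : 'cV_(d + m)], with
   components x = [usubmx z] and y = [dsubmx z]. *)
Section LP.
Context {R : realType} {m d : nat}.
Variables (A : 'M[R]_(m, d)) (b : 'cV[R]_m) (c : 'cV[R]_d).

Definition lp_feasible_set : set 'cV[R]_d :=
  [set x | nonneg x /\ A *m x = b].

Definition lp_feasible : Prop := lp_feasible_set !=set0.

Definition lp_bounded : Prop :=
  has_lbound [set dotv c x | x in lp_feasible_set].

Definition lagrangian (x : 'cV[R]_d) (y : 'cV[R]_m) : R :=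
  dotv c x + dotv y (A *m x) - dotv b y.

Definition saddle_points : set 'cV[R]_(d + m) :=
  [set z | nonneg (usubmx z) /\
    (forall y, lagrangian (usubmx z) y
                 <= lagrangian (usubmx z) (dsubmx z)) /\
    (forall x, nonneg x -> lagrangian (usubmx z) (dsubmx z)
                             <= lagrangian x (dsubmx z))].

Variable eta : R.

Definition pdhg (z : 'cV[R]_(d + m)) : 'cV[R]_(d + m) :=
  let x := usubmx z in
  let y := dsubmx z in
  let xp := proj (@nonneg R d) (x - eta *: (A^T *m y) - eta *: c) in
  let yp := y + eta *: (A *m (2 *: xp - x)) - eta *: b in
  col_mx xp yp.

Definition Pmx : 'M[R]_(d + m) :=
  block_mx (eta^-1)%:M (- A^T) (- A) (eta^-1)%:M.

Definition normP (z : 'cV[R]_(d + m)) : R := Num.sqrt (dotv z (Pmx *m z)).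

Definition distP (z : 'cV[R]_(d + m)) (U : set 'cV[R]_(d + m)) : R :=
  inf [set normP (z - u) | u in U].

End LP.

Section RestartedHalpern.
Context {R : realType} {n : nat}.
Variable T : 'cV[R]_n -> 'cV[R]_n.

Fixpoint reflected_halpern (z0 : 'cV[R]_n) (k : nat) : 'cV[R]_n :=
  if k is j.+1 then
    let z := reflected_halpern z0 j in
    (j.+1%:R / j.+2%:R) *: (2 *: T z - z) + (1 / j.+2%:R) *: z0
  else z0.

(* z^{l,0}, when every inner loop is terminated at counter K. *)
Fixpoint restart_point (K : nat) (z00 : 'cV[R]_n) (l : nat) : 'cV[R]_n :=
  if l is j.+1 then T (reflected_halpern (restart_point K z00 j) K) else z00.

(* z^{l,k}; only the values at k <= K are iterates of the algorithm. *)
Definition restarted_halpern (K : nat) (z00 : 'cV[R]_n) (l k : nat)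
    : 'cV[R]_n :=
  reflected_halpern (restart_point K z00 l) k.

End RestartedHalpern.

(* Main.v *)
Require Import Defs.
From HB Require Import structures.
From mathcomp Require Import all_boot all_order all_algebra.
From mathcomp Require Import all_classical all_reals.
From mathcomp Require Import sequences exp.
From mathcomp Require Import ring lra.

(** In the metric [P] the PDHG step [T] is a proximal point step, hence firmly
nonexpansive, with every saddle point fixed.  For [h = id - T] and the iterates
[z_k] of one reflected Halpern loop, the potential
[k |h z_k|^2 + <h z_k, z_k - z_0>] stays nonpositive, which gives
[(k + 1) |h z_k| <= |z_0 - u|] for every saddle point [u].  At [k = kstar],
sharpness turns this into a contraction of the distance by
[alpha (kstar + 1) >= e].  Sharpness is only available on a Euclidean ball; the
iterates never leave a [P]-ball around [zstar], and [eta |A| <= 1/2] makes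
[eta P] lie between 1/2 and 3/2, so the Euclidean distance of [T z] to [zstar]
grows by a factor of at most [sqrt 3 <= 2]. *)

Import Order.TTheory GRing.Theory Num.Theory.
Local Open Scope classical_set_scope.
Local Open Scope ring_scope.

(** * Bilinear forms in coordinates *)

Lemma dotvE {R : realType} {n} (u v : 'cV[R]_n) :
  dotv u v = \sum_i u i 0 * v i 0.
Proof. by rewrite /dotv mxE; apply: eq_bigr => i _; rewrite mxE. Qed.

(** A general matrix [M] lets one set of expansion rules serve both the Euclidean product ([M = 1])
    and the metric [P]. *)
Definition mform {R : realType} {n} (M : 'M[R]_n) (u v : 'cV[R]_n) : R :=
  dotv u (M *m v).

Section BilinearForm.
Context {R : realType} {n : nat}.
Variable M : 'M[R]_n.
Implicit Types u v w : 'cV[R]_n.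

Lemma mformDl u v w : mform M (u + v) w = mform M u w + mform M v w.
Proof. by rewrite /mform /dotv linearD mulmxDl mxE. Qed.

Lemma mformDr u v w : mform M w (u + v) = mform M w u + mform M w v.
Proof. by rewrite /mform /dotv !mulmxDr mxE. Qed.

Lemma mformZl (a : R) u v : mform M (a *: u) v = a * mform M u v.
Proof. by rewrite /mform /dotv linearZ -scalemxAl mxE. Qed.

Lemma mformZr (a : R) u v : mform M u (a *: v) = a * mform M u v.
Proof. by rewrite /mform /dotv -!scalemxAr mxE. Qed.

Lemma mformNl u v : mform M (- u) v = - mform M u v.
Proof. by rewrite -scaleN1r mformZl mulN1r. Qed.

Lemma mformNr u v : mform M u (- v) = - mform M u v.
Proof. by rewrite -scaleN1r mformZr mulN1r. Qed.

Definition mformE := (mformDl, mformDr, mformNl, mformNr, mformZl, mformZr).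

Hypothesis M_sym : M^T = M.

Lemma mformC u v : mform M u v = mform M v u.
Proof.
rewrite /mform /dotv -[in LHS](trmxK (M *m v)) -trmx_mul mxE.
by rewrite trmx_mul M_sym mulmxA.
Qed.

End BilinearForm.

Arguments mformC {R n M}.

(** * Euclidean geometry and the spectral norm *)

Section EuclideanSpace.
Context {R : realType}.

Lemma dotv_mform {n} (u v : 'cV[R]_n) : dotv u v = mform 1%:M u v.
Proof. by rewrite /mform mul1mx. Qed.

Lemma dotvC {n} (u v : 'cV[R]_n) : dotv u v = dotv v u.
Proof. by rewrite !dotv_mform mformC ?trmx1. Qed.

Lemma dotv_ge0 {n} (u : 'cV[R]_n) : 0 <= dotv u u.
Proof. by rewrite dotvE sumr_ge0 // => i _; rewrite -expr2 sqr_ge0. Qed.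

Lemma dotv_eq0 {n} (u : 'cV[R]_n) : dotv u u <= 0 -> u = 0.
Proof.
move=> u0; have /eqP : dotv u u = 0 by apply/le_anti; rewrite u0 dotv_ge0.
rewrite dotvE psumr_eq0 => [/allP u_eq0|i _]; last by rewrite -expr2 sqr_ge0.
apply/colP => i; rewrite mxE; apply/eqP.
by have := u_eq0 i (mem_index_enum i); rewrite /= mulf_eq0 orbb.
Qed.

Lemma dotv_subr {n} (u v w : 'cV[R]_n) :
  dotv (u - w) (u - w) =
    dotv (u - v) (u - v) - 2 * dotv (u - v) (w - v) + dotv (w - v) (w - v).
Proof.
have -> : u - w = (u - v) - (w - v) by rewrite opprB addrA subrK.
move: (u - v) (w - v) => x y.
rewrite !dotv_mform !mformE -!dotv_mform (dotvC y x); ring.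
Qed.

Lemma norm2_ge0 {n} (u : 'cV[R]_n) : 0 <= norm2 u.
Proof. exact: sqrtr_ge0. Qed.

Lemma sqr_norm2 {n} (u : 'cV[R]_n) : norm2 u ^+ 2 = dotv u u.
Proof. by rewrite sqr_sqrtr ?dotv_ge0. Qed.

Lemma ler_norm2 {n p} (u : 'cV[R]_n) (v : 'cV[R]_p) :
  (norm2 u <= norm2 v) = (dotv u u <= dotv v v).
Proof. by rewrite ler_sqrt ?dotv_ge0. Qed.

(** Expand the square of [norm2 v *: u - norm2 u *: v] and cancel [norm2 u * norm2 v]; zero vectors
    are split off so that this factor is positive. *)
Lemma cauchy_schwarz {n} (u v : 'cV[R]_n) : dotv u v <= norm2 u * norm2 v.
Proof.
have := dotv_ge0 (norm2 v *: u - norm2 u *: v).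
rewrite dotv_mform !mformE -!dotv_mform -!sqr_norm2 (dotvC v u).
have := norm2_ge0 u; have := norm2_ge0 v.
rewrite le_eqVlt => /predU1P[v0|v_gt0].
  have -> : v = 0 by apply: dotv_eq0; rewrite -sqr_norm2 -v0 expr0n.
  move=> _ _; rewrite dotvE big1 ?mulr_ge0 ?norm2_ge0 // => i _.
  by rewrite mxE mulr0.
rewrite le_eqVlt => /predU1P[u0|u_gt0].
  have -> : u = 0 by apply: dotv_eq0; rewrite -sqr_norm2 -u0 expr0n.
  move=> _; rewrite dotvE big1 ?mulr_ge0 ?norm2_ge0 // => i _.
  by rewrite mxE mul0r.
have uv_gt0 := mulr_gt0 u_gt0 v_gt0.
move=> H; rewrite -(ler_pM2l uv_gt0); lra.
Qed.

Lemma ler_norm2D {n} (u v : 'cV[R]_n) : norm2 (u + v) <= norm2 u + norm2 v.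
Proof.
rewrite -(ler_pXn2r (n := 2)) ?nnegrE ?addr_ge0 ?norm2_ge0 //.
rewrite sqr_norm2 sqrrD dotv_mform !mformE -!dotv_mform !sqr_norm2 (dotvC v u).
have := cauchy_schwarz u v; lra.
Qed.

Lemma norm2Z {n} (a : R) (u : 'cV[R]_n) : norm2 (a *: u) = `|a| * norm2 u.
Proof.
rewrite /norm2 dotv_mform !mformE -dotv_mform mulrA -expr2.
by rewrite sqrtrM ?sqr_ge0 // sqrtr_sqr.
Qed.

(** Guards against the default value of [sup]. Cauchy-Schwarz on each row bounds the set by the
    Frobenius norm. *)
Lemma spectral_norm_has_sup {m n} (A : 'M[R]_(m, n)) :
  has_sup [set norm2 (A *m x) | x in [set x : 'cV[R]_n | norm2 x <= 1]].
Proof.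
split.
  exists (norm2 (A *m 0)), 0 => //=.
  by rewrite -(scale0r 0) norm2Z normr0 mul0r.
exists (Num.sqrt (\sum_i norm2 (row i A)^T ^+ 2)) => _ [x /= x1 <-].
rewrite /norm2 ler_wsqrtr // dotvE ler_sum // => i _.
have -> : (A *m x) i 0 = dotv (row i A)^T x.
  by rewrite mxE dotvE; apply: eq_bigr => j _; rewrite !mxE.
rewrite -expr2 -[X in _ <= X]/(_ ^+ 2) -real_normK ?num_real //.
rewrite ler_pXn2r ?nnegrE ?norm2_ge0 //.
apply: (@le_trans _ _ (norm2 (row i A)^T * norm2 x)); last first.
  by rewrite ler_piMr ?norm2_ge0.
rewrite ler_norml cauchy_schwarz andbT lerNl.
have := cauchy_schwarz (- (row i A)^T) x.
by rewrite dotv_mform mformE -dotv_mform -scaleN1r norm2Z normrN1 mul1r.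
Qed.

Lemma spectral_norm_ge0 {m n} (A : 'M[R]_(m, n)) : 0 <= spectral_norm A.
Proof.
have /ubP ub := sup_upper_bound (spectral_norm_has_sup A).
apply: le_trans (norm2_ge0 (A *m 0)) _; apply: ub; exists 0 => //=.
by rewrite -(scale0r 0) norm2Z normr0 mul0r.
Qed.

Lemma norm2_mulmx {m n} (A : 'M[R]_(m, n)) (x : 'cV[R]_n) :
  norm2 (A *m x) <= spectral_norm A * norm2 x.
Proof.
have := norm2_ge0 x; rewrite le_eqVlt => /predU1P[x0|x_gt0].
  have -> : x = 0 by apply: dotv_eq0; rewrite -sqr_norm2 -x0 expr0n.
  by rewrite mulmx0 -(scale0r 0) norm2Z normr0 mul0r -(scale0r 0) norm2Z
    normr0 mul0r mulr0.
have /ubP ub := sup_upper_bound (spectral_norm_has_sup A).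
rewrite -ler_pdivrMr // mulrC -[X in X * _]ger0_norm ?invr_ge0 ?norm2_ge0 //.
rewrite -norm2Z scalemxAr; apply: ub; exists ((norm2 x)^-1 *: x) => //=.
by rewrite norm2Z ger0_norm ?invr_ge0 ?norm2_ge0 // mulVf // gt_eqF.
Qed.

End EuclideanSpace.

(** * Projection onto the nonnegative orthant *)

Section ProjectionOntoOrthant.
Context {R : realType} {n : nat}.
Implicit Types v p q : 'cV[R]_n.

(** Testing each inequality at the other point and adding leaves [dotv (p - p') (p - p') <= 0]. *)
Lemma nonneg_variational_uniq v p p' :
    nonneg p -> (forall q, nonneg q -> dotv (v - p) (q - p) <= 0) ->
    nonneg p' -> (forall q, nonneg q -> dotv (v - p') (q - p') <= 0) ->
  p = p'.
Proof.
move=> p0 /(_ p') + p'0 /(_ p) => /(_ p'0) H1 /(_ p0) H2.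
apply/eqP; rewrite -subr_eq0; apply/eqP/dotv_eq0; move: H1 H2.
rewrite !dotv_mform !mformE; lra.
Qed.

Lemma proj_nonneg v :
  nonneg (Defs.proj (@nonneg R n) v) /\
  forall q, nonneg q ->
    dotv (v - Defs.proj (@nonneg R n) v) (q - Defs.proj (@nonneg R n) v) <= 0.
Proof.
pose p0 : 'cV[R]_n := \col_i Num.max (v i 0) 0.
have p0P : nonneg p0 by move=> i; rewrite mxE le_max lexx orbT.
have p0_vi q : nonneg q -> dotv (v - p0) (q - p0) <= 0.
  move=> q0; rewrite dotvE sumr_le0 // => i _; rewrite !mxE.
  have := q0 i; have [?|?] := leP (v i 0) 0; nra.
suff -> : Defs.proj (@nonneg R n) v = p0 by [].
(* The default branch of [xget] is refuted by [p0], itself a minimiser; in the other branch the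
   minimiser [p] is compared with [p0]. *)
rewrite /Defs.proj; case: xgetP => [p _ [pP p_min]|/(_ p0) []]; last first.
  split=> // q q0; rewrite ler_norm2 (dotv_subr v p0 q).
  have := p0_vi q q0; have := dotv_ge0 (q - p0); lra.
apply/eqP; rewrite -subr_eq0; apply/eqP/dotv_eq0.
have := p_min p0 p0P; rewrite ler_norm2 (dotv_subr v p0 p).
have := p0_vi p pP; lra.
Qed.

Lemma proj_nonneg_eq v p :
    nonneg p -> (forall q, nonneg q -> dotv (v - p) (q - p) <= 0) ->
  Defs.proj (@nonneg R n) v = p.
Proof.
move=> pP p_vi; have [qP q_vi] := proj_nonneg v.
exact: nonneg_variational_uniq qP q_vi pP p_vi.
Qed.

End ProjectionOntoOrthant.

(** * Halpern iteration of a firmly nonexpansive map *)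

Section Halpern.
Context {R : realType} {n : nat}.
Variables (M : 'M[R]_n) (T : 'cV[R]_n -> 'cV[R]_n).
Hypothesis M_sym : M^T = M.
Hypothesis M_ge0 : forall z, 0 <= mform M z z.

Let h z := z - T z.

Hypothesis T_firm : forall z w,
  mform M (h z - h w) (h z - h w) <= mform M (h z - h w) (z - w).

Lemma firm_fixed u z : T u = u ->
  mform M (h z) (h z) <= mform M (h z) (z - u).
Proof.
move=> Tu; have := T_firm z u.
by have -> : h u = 0; rewrite ?subr0 // /h Tu subrr.
Qed.

Lemma firm_nonexpansive u z : T u = u ->
  mform M (T z - u) (T z - u) <= mform M (z - u) (z - u).
Proof.
move=> Tu; have := firm_fixed u z Tu; have := M_ge0 (h z).
have -> : T z - u = (z - u) - h z by rewrite /h; apply/colP=> i; rewrite !mxE; ring.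
move: (h z) (z - u) => H w; rewrite !mformE (mformC M_sym w H); lra.
Qed.

(** Firmness makes the reflection [2 T - id = id - 2 h] nonexpansive about [u], and each iterate is
    a convex combination of a reflected point and [z0]. *)
Lemma reflected_halpern_bounded u z0 k : T u = u ->
  mform M (reflected_halpern T z0 k - u) (reflected_halpern T z0 k - u)
    <= mform M (z0 - u) (z0 - u).
Proof.
move=> Tu; elim: k => [//|k]; set z := reflected_halpern T z0 k => IH /=.
rewrite -/z; have := firm_fixed u z Tu.
have k2 : k.+2%:R != 0 :> R by rewrite pnatr_eq0.
set t : R := k.+1%:R / k.+2%:R.
have -> : 1 / k.+2%:R = 1 - t :> R.
  by rewrite /t -[X in X - _](divff k2) -mulrBl -natrB // subSnn.
have t0 : 0 <= t by rewrite divr_ge0.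
have t1 : t <= 1 by rewrite ler_pdivrMr ?ltr0n // mul1r ler_nat.
have -> : t *: (2 *: T z - z) + (1 - t) *: z0 - u =
    t *: ((z - u) - 2 *: h z) + (1 - t) *: (z0 - u).
  by rewrite /h; apply/colP=> i; rewrite !mxE; ring.
(* Weighted by [t (1 - t)], this square is the convexity gap of the squared norm. *)
move: IH; have := M_ge0 ((z - u) - 2 *: h z - (z0 - u)).
move: (h z) (z - u) (z0 - u) => H w w0.
rewrite !mformE (mformC M_sym w H) (mformC M_sym w w0) (mformC M_sym w0 H).
move: (mform M H H) (mform M H w) (mform M H w0) (mform M w w)
  (mform M w0 w) (mform M w0 w0) => a1 a2 a3 a4 a5 a6 cvx IH firm.
have t1' : 0 <= 1 - t by rewrite subr_ge0.
have := mulr_ge0 (mulr_ge0 t0 t1') cvx.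
have : 0 <= t * (a2 - a1) by rewrite mulr_ge0 // subr_ge0.
have : 0 <= t * (a6 - a4) by rewrite mulr_ge0 // subr_ge0.
lra.
Qed.

(** The inductive step adds [k + 1] times firmness between consecutive iterates to [t] times the
    induction hypothesis, with [t = (k + 1) / (k + 2)]; the terms match because
    [(k + 1) (1 - t) = t]. *)
Lemma reflected_halpern_potential z0 k :
  let z := reflected_halpern T z0 k in
  k%:R * mform M (h z) (h z) + mform M (h z) (z - z0) <= 0.
Proof.
elim: k => [|k].
  by rewrite /= mul0r add0r subrr -(scale0r 0) mformZr mul0r.
cbv zeta; set z := reflected_halpern T z0 k => IH.
set z' := reflected_halpern T z0 k.+1.
have k1 : k.+1%:R != 0 :> R by rewrite pnatr_eq0.
have k2 : k.+2%:R != 0 :> R by rewrite pnatr_eq0.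
set t : R := k.+1%:R / k.+2%:R.
have z'E : z' - z0 = t *: ((z - z0) - 2 *: h z).
  rewrite /z' /= -/z -/t; have -> : 1 / k.+2%:R = 1 - t :> R.
    by rewrite /t -[X in X - _](divff k2) -mulrBl -natrB // subSnn.
  by rewrite /h; apply/colP=> i; rewrite !mxE; ring.
have := T_firm z' z.
have -> : z' - z = (z' - z0) - (z - z0) by rewrite opprB addrA subrK.
rewrite z'E; move: IH; move: (h z) (h z') (z - z0) => H H' w.
rewrite !mformE (mformC M_sym H' H).
move: (mform M H H) (mform M H w) (mform M H H') (mform M H' w)
  (mform M H' H') => a1 a2 a3 a4 a5 IH firm.
have tE : t * (k%:R + 2) = k%:R + 1.
  by rewrite /t natr1 -natrD addn2 divfK.
have k0 : 0 <= k%:R :> R by [].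
rewrite -natr1; move: (k%:R) k0 tE IH => K K0 tE IH.
(* Eliminates the products [t * K * a], leaving a goal linear in the remaining monomials. *)
have tK a : t * K * a = K * a + a - 2 * t * a.
  have -> : K * a + a - 2 * t * a = (K + 1 - 2 * t) * a by ring.
  by rewrite -tE; ring.
have t0 : 0 <= t by rewrite divr_ge0.
have firmK := ler_wpM2l (addr_ge0 K0 ler01) firm.
have := ler_wpM2l t0 IH.
have := (tK a1, tK a2, tK a3, tK a4) => -[[[]]]; lra.
Qed.

(* Adding firmness at a fixed point to the potential inequality gives
   (k+1) |h|^2 <= <h, z0 - u>, hence the rate. *)
Lemma reflected_halpern_rate u z0 k : T u = u ->
  let z := reflected_halpern T z0 k in
  k.+1%:R ^+ 2 * mform M (h z) (h z) <= mform M (z0 - u) (z0 - u).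
Proof.
move=> Tu; have := reflected_halpern_potential z0 k; cbv zeta.
move: (reflected_halpern T z0 k) => z.
(* This square stands in for Cauchy-Schwarz in the semidefinite form [M]. *)
have := firm_fixed u z Tu; have := M_ge0 (z0 - u - k.+1%:R *: h z).
have -> : z - z0 = (z - u) - (z0 - u) by rewrite opprB addrA subrK.
rewrite -natr1; have : 0 <= k%:R :> R by [].
move: (h z) (z - u) (z0 - u) k%:R => H w w0 K K0.
rewrite !mformE (mformC M_sym w0 H); nra.
Qed.

End Halpern.

(** * The PDHG step in the metric [P] *)

Lemma dotv_col_mx {R : realType} {m n} (x x' : 'cV[R]_m) (y y' : 'cV[R]_n) :
  dotv (col_mx x y) (col_mx x' y') = dotv x x' + dotv y y'.
Proof. by rewrite /dotv tr_col_mx mul_row_col mxE. Qed.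

Lemma dotv_trmx {R : realType} {m n} (A : 'M[R]_(m, n))
  (x : 'cV[R]_n) (y : 'cV[R]_m) : dotv x (A^T *m y) = dotv y (A *m x).
Proof. by rewrite dotvC /dotv trmx_mul trmxK mulmxA. Qed.

Section PDHG.
Context {R : realType} {m d : nat}.
Variables (A : 'M[R]_(m, d)) (b : 'cV[R]_m) (c : 'cV[R]_d) (eta : R).
Hypothesis eta_gt0 : 0 < eta.
Hypothesis eta_le : eta <= 1 / (2 * spectral_norm A).

Local Notation P := (Pmx A eta).
Local Notation T := (pdhg A b c eta).

Lemma eta_spectral_norm : eta * spectral_norm A <= 1 / 2.
Proof.
have := spectral_norm_ge0 A; rewrite le_eqVlt => /predU1P[S0|S_gt0].
  by rewrite -S0 mulr0 divr_ge0.
apply: le_trans (ler_wpM2r (ltW S_gt0) eta_le) _.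
by rewrite invfM mul1r -mulrA mulVf ?gt_eqF // mulr1 mul1r.
Qed.

Lemma Pmx_sym : P^T = P.
Proof. by rewrite tr_block_mx !tr_scalar_mx !linearN /= trmxK. Qed.

Lemma mform_Pmx z : eta * mform P z z =
  dotv z z - 2 * (eta * dotv (dsubmx z) (A *m usubmx z)).
Proof.
rewrite -[z]vsubmxK; move: (usubmx z) (dsubmx z) => x y.
rewrite col_mxKu col_mxKd /mform mul_block_col !mul_scalar_mx !mulNmx.
rewrite !dotv_col_mx !dotv_mform !mformE -!dotv_mform dotv_trmx.
by field; rewrite gt_eqF.
Qed.

(** Since [eta |A| <= 1/2], the cross term [2 eta <y, A x>] is at most half of [|z|^2] in absolute
    value. *)
Lemma Pmx_bounds z :
  dotv z z / 2 <= eta * mform P z z /\ eta * mform P z z <= 3 / 2 * dotv z z.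
Proof.
rewrite mform_Pmx -[z]vsubmxK; move: (usubmx z) (dsubmx z) => x y.
rewrite col_mxKu col_mxKd dotv_col_mx.
have Ax : eta ^+ 2 * dotv (A *m x) (A *m x) <= dotv x x / 4.
  rewrite -!sqr_norm2 -exprMn.
  have -> : norm2 x ^+ 2 / 4 = (1 / 2 * norm2 x) ^+ 2 by field.
  rewrite ler_pXn2r ?nnegrE ?mulr_ge0 ?norm2_ge0 ?invr_ge0 ?(ltW eta_gt0) //.
  apply: le_trans (ler_wpM2l (ltW eta_gt0) (norm2_mulmx A x)) _.
  by rewrite mulrA ler_wpM2r ?norm2_ge0 ?eta_spectral_norm.
(* Young: [2 eta |<y, A x>| <= 2 eta^2 |A x|^2 + |y|^2 / 2]. *)
have := dotv_ge0 ((2 * eta) *: (A *m x) - y).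
have := dotv_ge0 ((2 * eta) *: (A *m x) + y).
rewrite !dotv_mform !mformE -!dotv_mform (dotvC (A *m x) y).
by move=> H1 H2; split; lra.
Qed.

Lemma Pmx_ge0 z : 0 <= mform P z z.
Proof.
have [+ _] := Pmx_bounds z; rewrite -(pmulr_rge0 _ eta_gt0).
by apply: le_trans; rewrite divr_ge0 ?dotv_ge0.
Qed.

Lemma sqr_normP z : normP A eta z ^+ 2 = mform P z z.
Proof. by rewrite sqr_sqrtr ?Pmx_ge0. Qed.

Lemma ler_normP z w :
  (normP A eta z <= normP A eta w) = (mform P z z <= mform P w w).
Proof. by rewrite ler_sqrt ?Pmx_ge0. Qed.

(* The PDHG step is a proximal point step in the P-metric: P (z - T z) lies in
   the saddle operator evaluated at T z, the normal cone being represented by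
   the projection residual. *)
Lemma mulmx_Pmx_residual z :
  P *m (z - T z) =
  col_mx (eta^-1 *: (usubmx z - eta *: (A^T *m dsubmx z) - eta *: c
                     - usubmx (T z)) + c + A^T *m dsubmx (T z))
         (b - A *m usubmx (T z)).
Proof.
rewrite -{1}[z]vsubmxK {1}/pdhg.
set xp := Defs.proj _ _; set yp := _ - eta *: b.
have -> : usubmx (T z) = xp by rewrite col_mxKu.
have -> : dsubmx (T z) = yp by rewrite col_mxKd.
rewrite opp_col_mx add_col_mx mul_block_col !mul_scalar_mx !mulNmx.
congr col_mx.
  rewrite mulmxBr; move: (A^T *m yp) (A^T *m _) (usubmx z) => y1 y0 x0.
  by apply/colP => i; rewrite !mxE; field; rewrite gt_eqF.
rewrite /yp !mulmxBr -scalemxAr.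
move: (A *m xp) (A *m _) (dsubmx z) => x1 x0 y0.
by apply/colP => i; rewrite !mxE; field; rewrite gt_eqF.
Qed.

Lemma pdhg_vi z :
  nonneg (usubmx (T z)) /\
  forall q, nonneg q ->
    dotv (usubmx z - eta *: (A^T *m dsubmx z) - eta *: c - usubmx (T z))
         (q - usubmx (T z)) <= 0.
Proof. by rewrite col_mxKu; exact: proj_nonneg. Qed.

(** Splitting [z - w] into residual and image differences reduces the claim to monotonicity of the
    saddle operator: its bilinear part is skew and cancels, and its normal cone part has a sign. *)
Lemma pdhg_firm z w :
  mform P ((z - T z) - (w - T w)) ((z - T z) - (w - T w)) <=
  mform P ((z - T z) - (w - T w)) (z - w).
Proof.
have := mulmx_Pmx_residual z; have := mulmx_Pmx_residual w.
have [] := pdhg_vi z; have [] := pdhg_vi w.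
set v' := _ - _ - eta *: c; set v := _ - _ - eta *: c.
move: v v' (T z) (T w) => v v' z' w' w_ge0 w_vi z_ge0 z_vi Pw Pz.
have E : z - w = ((z - z') - (w - w')) + (z' - w').
  by apply/colP => i; rewrite !mxE; ring.
rewrite E (mformDr P _ (z' - w')) lerDl (mformC Pmx_sym) /mform mulmxBr Pz Pw.
rewrite -{1}[z']vsubmxK -{1}[w']vsubmxK !opp_col_mx !add_col_mx dotv_col_mx.
have e_ge0 : 0 <= eta^-1 by rewrite invr_ge0 ltW.
(* Each projection inequality is tested at the other image point, with the factor [eta^-1] carried
   by the residual. *)
move: (ler_wpM2l e_ge0 (z_vi _ w_ge0)) (ler_wpM2l e_ge0 (w_vi _ z_ge0)).
move: (usubmx z') (usubmx w') (dsubmx z') (dsubmx w') => x x' y y'.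
rewrite mulr0 !dotv_mform !mformE -!dotv_mform !dotv_trmx.
rewrite (dotvC x v) (dotvC x v') (dotvC x' v) (dotvC x' v') (dotvC x' x).
lra.
Qed.

Lemma saddle_point_pdhg_fixed u : saddle_points A b c u -> T u = u.
Proof.
move=> [u_ge0 [u_max u_min]]; rewrite -[RHS]vsubmxK /pdhg.
have Au : A *m usubmx u = b.
  apply/eqP; rewrite -subr_eq0; apply/eqP/dotv_eq0.
  (* Moving [y] by [A x - b] raises the Lagrangian by [|A x - b|^2], so maximality forces primal
     feasibility. *)
  have := u_max (dsubmx u + (A *m usubmx u - b)); rewrite /lagrangian.
  move: (A *m usubmx u) (dsubmx u) => a y.
  rewrite !dotv_mform !mformE -!dotv_mform (dotvC a b); lra.
have -> : Defs.proj (@nonneg R d)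
    (usubmx u - eta *: (A^T *m dsubmx u) - eta *: c) = usubmx u.
  (* The variational inequality here is [eta] times minimality of the Lagrangian in [x]. *)
  apply: proj_nonneg_eq => // q q_ge0; have := u_min q q_ge0.
  rewrite /lagrangian -!(dotv_trmx A); move: (A^T *m _) (usubmx u) => a x.
  have -> : x - eta *: a - eta *: c - x = - (eta *: (a + c)).
    by apply/colP => i; rewrite !mxE; ring.
  rewrite !dotv_mform !mformE -!dotv_mform.
  rewrite (dotvC a q) (dotvC a x) => le; have := ler_wpM2l (ltW eta_gt0) le.
  lra.
congr col_mx; rewrite mulmxBr -scalemxAr Au.
by apply/colP => i; rewrite !mxE; ring.
Qed.

End PDHG.

(** * Distance to a set in the [P]-norm *)

Section Distance.
Context {R : realType} {m d : nat}.
Variables (A : 'M[R]_(m, d)) (eta : R) (U : set 'cV[R]_(d + m)).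
Hypothesis U_neq0 : U !=set0.

Lemma distP_le z u : U u -> distP A eta z U <= normP A eta (z - u).
Proof.
move=> Uu; apply: ge_inf; last by exists u.
by exists 0 => _ [v _ <-]; exact: sqrtr_ge0.
Qed.

(** Nonemptiness of [U] matters: the infimum of the empty set is 0 by convention. *)
Lemma le_distP a z :
  (forall u, U u -> a <= normP A eta (z - u)) -> a <= distP A eta z U.
Proof.
move=> a_le; apply: lb_le_inf => [|_ [u Uu <-]]; last exact: a_le.
by have [u Uu] := U_neq0; exists (normP A eta (z - u)), u.
Qed.

Lemma distP_ge0 z : 0 <= distP A eta z U.
Proof. by apply: le_distP => u _; exact: sqrtr_ge0. Qed.

End Distance.

(** * Contraction over the outer loops *)

Theorem theorem6 (R : realType) (m d : nat)
    (A : 'M[R]_(m, d)) (b : 'cV[R]_m) (c : 'cV[R]_d)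
    (A_neq0 : A != 0)
    (feas : lp_feasible A b)
    (bnd : lp_bounded A b c)
    (eta : R) (eta_gt0 : 0 < eta)
    (eta_le : eta <= 1 / (2 * spectral_norm A))
    (z00 zstar : 'cV[R]_(d + m))
    (zstarP : saddle_points A b c zstar)
    (alpha : R) (alpha_gt0 : 0 < alpha)
    (sharp : forall z : 'cV[R]_(d + m),
       norm2 (pdhg A b c eta z) <= 2 * (norm2 (z00 - zstar) + norm2 zstar) ->
       alpha * distP A eta z (saddle_points A b c)
         <= normP A eta (z - pdhg A b c eta z))
    (kstar : nat) (kstarE : kstar%:Z = Num.ceil (expR 1 / alpha)) :
  forall n : nat,
    distP A eta (restarted_halpern (pdhg A b c eta) kstar z00 n.+1 0)
          (saddle_points A b c)
    <= (1 / expR 1) ^+ n.+1 * distP A eta z00 (saddle_points A b c).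
Proof.
set T := pdhg A b c eta; set Z := saddle_points A b c.
pose P := Pmx A eta.
have Z_neq0 : Z !=set0 by exists zstar.
have Z_fixed u : Z u -> T u = u by exact: saddle_point_pdhg_fixed.
have P_sym : P^T = P by exact: Pmx_sym.
have P_ge0 z : 0 <= mform P z z by exact: Pmx_ge0.
have T_firm := @pdhg_firm _ _ _ A b c _ eta_gt0.
have T_le := @firm_nonexpansive _ _ P T P_sym P_ge0 T_firm.
have H_le := @reflected_halpern_bounded _ _ P T P_sym P_ge0 T_firm.
have rate := @reflected_halpern_rate _ _ P T P_sym P_ge0 T_firm.
have T_bounded w : mform P (w - zstar) (w - zstar)
      <= mform P (z00 - zstar) (z00 - zstar) ->
    norm2 (T w) <= 2 * (norm2 (z00 - zstar) + norm2 zstar).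
  move=> /(le_trans (T_le _ w (Z_fixed _ zstarP))).
  have [+ _] := Pmx_bounds A _ eta_gt0 eta_le (T w - zstar).
  have [_] := Pmx_bounds A _ eta_gt0 eta_le (z00 - zstar).
  move=> le1 le2 /(ler_wpM2l (ltW eta_gt0)) le3.
  (* The bounds 1/2 and 3/2 on [eta P] give a factor 3 between the squares, which is below
     [2 ^ 2]. *)
  have : norm2 (T w - zstar) <= 2 * norm2 (z00 - zstar).
    rewrite -(ler_pXn2r (n := 2)) ?nnegrE ?mulr_ge0 ?norm2_ge0 //.
    rewrite exprMn !sqr_norm2; have := dotv_ge0 (z00 - zstar); lra.
  have := ler_norm2D (T w - zstar) zstar; rewrite subrK.
  have := norm2_ge0 zstar; lra.
have restart_bounded n :
    mform P (restart_point T kstar z00 n - zstar)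
            (restart_point T kstar z00 n - zstar)
      <= mform P (z00 - zstar) (z00 - zstar).
  elim: n => [//|n IH] /=; apply: le_trans (T_le _ _ (Z_fixed _ zstarP)) _.
  exact: le_trans (H_le _ _ _ (Z_fixed _ zstarP)) IH.
(* The rate carries the factor [kstar + 1], so the ceiling suffices with room to spare. *)
have k_ge : expR 1 / alpha <= kstar.+1%:R.
  apply: le_trans (ceil_ge _) _.
  by rewrite -kstarE /= ler_nat.
have step n : distP A eta (restart_point T kstar z00 n.+1) Z
    <= 1 / expR 1 * distP A eta (restart_point T kstar z00 n) Z.
  rewrite /=; set z0 := restart_point T kstar z00 n.
  set z := reflected_halpern T z0 kstar.
  have Tz_le : distP A eta (T z) Z <= distP A eta z Z.
    apply: le_distP => // u Zu; apply: le_trans (distP_le _ _ _ _ _ Zu) _.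
    by rewrite (ler_normP A _ eta_gt0 eta_le) T_le // Z_fixed.
  have h_le : kstar.+1%:R * normP A eta (z - T z) <= distP A eta z0 Z.
    (* The rate holds for every saddle point [u], so an infimum over [u] replaces the choice of a
       nearest one. *)
    apply: le_distP => // u Zu.
    rewrite -(ler_pXn2r (n := 2)) ?nnegrE ?mulr_ge0 ?sqrtr_ge0 //.
    rewrite exprMn !(sqr_normP A _ eta_gt0 eta_le); exact: rate (Z_fixed _ Zu).
  have z_sharp : alpha * distP A eta z Z <= normP A eta (z - T z).
    apply/sharp/T_bounded.
    exact: le_trans (H_le _ _ _ (Z_fixed _ zstarP)) (restart_bounded n).
  have e_gt0 : 0 < expR 1 :> R by exact: expR_gt0.
  (* The chain is [e dist(T z) <= (kstar + 1) alpha dist(z) <= (kstar + 1) |z - T z| <=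
     dist(z0)]. *)
  rewrite mul1r mulrC ler_pdivlMr // mulrC.
  apply: le_trans h_le; apply: le_trans (ler_wpM2l (ler0n _ _) z_sharp).
  rewrite mulrA; apply: ler_pM => //; [exact: ltW | exact: distP_ge0 |].
  by rewrite -ler_pdivrMr.
rewrite /restarted_halpern; elim=> [|n IH]; first by rewrite expr1; exact: step.
apply: le_trans (step _) _; rewrite exprS -[leRHS]mulrA ler_wpM2l //.
by rewrite divr_ge0 ?expR_ge0.
Qed.
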